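(* Suppose that $A_\infty(\mathcal{B})=\bigcup_{1<\delta<\infty}RH_\delta(\mathcal{B})$. Assume that for some $w_0\in A_\infty(\mathcal{B})$, $X_{w_0}(\mathcal{B},\Lambda)$ satisfies the $p$-power John-Nirenberg property for the interval $[1,\infty)$, and that $X_{w_0}^p(\mathcal{B},\Lambda)=X_{w_0}(\mathcal{B},\Lambda)$ for all $0<p<1$. Then $X(\mathcal{B},\Lambda)$ satisfies the weight invariance property for $A_\infty(\mathcal{B})$, and $X_w(\mathcal{B},\Lambda)$ satisfies the $p$-power John-Nirenberg property for $(0,\infty)$ for every $w\in A_\infty(\mathcal{B})$. Furthermore, if $w_0\in A_p(\mathcal{B})\cap RH_\sigma(\mathcal{B})$ and $w\in A_q(\mathcal{B})\cap RH_\delta(\mathcal{B})$ with $1<p,q,\delta,\sigma<\infty$, then $$b_{w_0,w}\le c_{1,p\delta'}(w_0)\,[w_0]_{A_p}^{\frac1{p\delta'}}\,[w]_{RH_\delta},$$ $$b_{w,w_0}\le c_{(q\sigma')^{-1},1}(w_0)\,[w]_{A_q}\,[w_0]_{RH_\sigma}^{q\sigma'},$$ and, for all $1<t<\infty$, $$c_{1,t}(w)\le c_{1,tp\delta'}(w_0)\,b_{w,w_0}\,[w_0]_{A_p}^{\frac1{p\delta' t}}\,[w]_{RH_\delta}^{\frac1t}.$$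
   Context: Setting. $(Y,\Sigma,\mu)$ is a measure space with $\mu$ non-negative and $\sigma$-finite, and $\mathcal{B}\subset\Sigma$ is a collection of sets with $0<\mu(B)<\infty$ for all $B\in\mathcal{B}$. A function is locally $\mu$-integrable if it is $\mu$-measurable and integrable over every $B\in\mathcal{B}$. For $1<p<\infty$, $p'=p/(p-1)$. Weights. For $1<p<\infty$, a non-negative locally $\mu$-integrable function $w$ belongs to $A_p(\mathcal{B})$ if $$[w]_{A_p}=\sup_{B\in\mathcal{B}}\Big(\frac1{\mu(B)}\int_B w\,d\mu\Big)\Big(\frac1{\mu(B)}\int_B w^{-p'/p}\,d\mu\Big)^{p/p'}<\infty$$ (finiteness includes finiteness of each average, so $0<w(B)<\infty$, where $w(B)=\int_B w\,d\mu$). $A_\infty(\mathcal{B})=\bigcup_{1<p<\infty}A_p(\mathcal{B})$. For $1<\delta<\infty$, $RH_\delta(\mathcal{B})$ is the set of $w\in A_\infty(\mathcal{B})$ for which there is a constant $C$ with $\big(\frac1{\mu(B)}\int_B w^\delta d\mu\big)^{1/\delta}\le C\,\frac1{\mu(B)}\int_B w\,d\mu$ for all $B\in\mathcal{B}$; $[w]_{RH_\delta}$ is the smallest such $C$. Oscillation spaces. $\mathfrak{F}$ is a set and $\Lambda$ assigns to each $(f,B)\in\mathfrak{F}\times\mathcal{B}$ a non-negative $\mu$-measurable function $\Lambda(f,B)$ on $Y$. For $w\in A_\infty(\mathcal{B})$ and $0<p<\infty$, put $\|f\|_{X_w^p}=\Big(\sup_{B\in\mathcal{B}}\frac1{w(B)}\int_B\Lambda(f,B)^p\,w\,d\mu\Big)^{1/p}\in[0,\infty]$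 and let $X_w^p(\mathcal{B},\Lambda)=\{f\in\mathfrak{F}:\|f\|_{X_w^p}<\infty\}$. Write $X^p=X_1^p$, $X_w=X_w^1$, $X=X_1^1$. (No vector space or norm structure is assumed.) Weight invariance. $X(\mathcal{B},\Lambda)$ satisfies the weight invariance property for $\mathcal{W}\subset A_\infty(\mathcal{B})$ if for all $w,v\in\mathcal{W}$, $X_w(\mathcal{B},\Lambda)=X_v(\mathcal{B},\Lambda)$ and there is a constant $b_{w,v}>0$ with $\|f\|_{X_v}\le b_{w,v}\|f\|_{X_w}$ for all $f\in X_w(\mathcal{B},\Lambda)$; $b_{w,v}$ denotes the smallest such constant. $p$-power John-Nirenberg property. $X_w(\mathcal{B},\Lambda)$ satisfies this property for an interval $I\subset(0,\infty)$ if for any $p<q$ in $I$ there is a constant $C>0$ (possibly depending on $w,p,q$) such that $\|f\|_{X_w^q}\le C\|f\|_{X_w^p}$ for all $f\in X_w(\mathcal{B},\Lambda)$. The infimum of such constants is $c_{p,q}(w)$. *)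

(* Defs.v *)
From HB Require Import structures.
From mathcomp Require Import all_boot all_order all_algebra.
From mathcomp Require Import all_classical all_reals all_analysis.
Set Implicit Arguments.
Unset Strict Implicit.
Unset Printing Implicit Defensive.
Import Order.TTheory GRing.Theory Num.Theory.
Local Open Scope classical_set_scope.
Local Open Scope ring_scope.
Local Open Scope ereal_scope.

Definition conj_exp {R : realType} (p : R) : R := (p / (p - 1))%R.

(* Supremum of a [0, +oo]-valued family: adding 0 makes the supremum over an
   empty family equal to 0 (and not -oo), and changes nothing otherwise. *)
Definition nnsup {R : realType} {T : Type} (A : set T) (F : T -> \bar R) :
    \bar R :=
  ereal_sup (0 |` (F @` A)).

Section weights.
Context {d : measure_display} {Y : measurableType d} {R : realType}.
Variables (mu : {measure set Y -> \bar R}) (BB : set (set Y)).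

Definition average (B : set Y) (g : Y -> \bar R) : \bar R :=
  (\int[mu]_(x in B) g x) / mu B.

Definition locally_integrable (w : Y -> R) : Prop :=
  measurable_fun [set: Y] w /\
  forall B, BB B -> mu.-integrable B (EFin \o w).

(* w^{-s} for s > 0, with value +oo where w vanishes; [powR] cannot be used
   directly with a negative exponent, since it sends 0 to 0. *)
Definition neg_pow (w : Y -> R) (s : R) (x : Y) : \bar R :=
  ((w x `^ s)%R%:E)^-1.

Definition Ap_const (p : R) (w : Y -> R) : \bar R :=
  nnsup BB (fun B =>
    average B (EFin \o w)
    * (average B (neg_pow w (conj_exp p / p))) `^ (p / conj_exp p)).

(* The third clause is needed because 0 * +oo = 0 in \bar R: it makes the
   finiteness of [Ap_const] include that of each average. *)
Definition Ap (p : R) : set (Y -> R) :=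
  [set w | [/\ forall x, (0 <= w x)%R,
               locally_integrable w,
               forall B, BB B ->
                 average B (neg_pow w (conj_exp p / p)) < +oo
             & Ap_const p w < +oo]].

Definition Ainfty : set (Y -> R) :=
  \bigcup_(p in [set p : R | (1 < p)%R]) Ap p.

Definition RH_bound (delta : R) (w : Y -> R) (C : R) : Prop :=
  forall B, BB B ->
    (average B (fun x => (w x `^ delta)%R%:E)) `^ delta^-1
      <= C%:E * average B (EFin \o w).

Definition RH (delta : R) : set (Y -> R) :=
  [set w | Ainfty w /\ exists2 C : R, (0 <= C)%R & RH_bound delta w C].

Definition RH_const (delta : R) (w : Y -> R) : \bar R :=
  ereal_inf [set C%:E | C in [set C : R | (0 <= C)%R /\ RH_bound delta w C]].

End weights.

Section oscillation.
Context {d : measure_display} {Y : measurableType d} {R : realType}.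
Variables (mu : {measure set Y -> \bar R}) (BB : set (set Y)).
(* Only the values [Lam f B] with [BB B] are ever used. *)
Context {F : Type}.
Variable Lam : F -> set Y -> Y -> R.

Definition Xnorm (w : Y -> R) (p : R) (f : F) : \bar R :=
  (nnsup BB (fun B =>
     (\int[mu]_(x in B) (Lam f B x `^ p * w x)%R%:E)
     / (\int[mu]_(x in B) (w x)%:E))) `^ p^-1.

Definition Xspace (w : Y -> R) (p : R) : set F :=
  [set f | Xnorm w p f < +oo].

Definition invariance_bound (w v : Y -> R) (b : R) : Prop :=
  forall f, Xspace w 1 f -> Xnorm v 1 f <= b%:E * Xnorm w 1 f.

Definition weight_invariance (W : set (Y -> R)) : Prop :=
  forall w v, W w -> W v ->
    Xspace w 1 = Xspace v 1 /\
    exists2 b : R, (0 < b)%R & invariance_bound w v b.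

Definition invariance_const (w v : Y -> R) : \bar R :=
  ereal_inf [set b%:E | b in
    [set b : R | (0 < b)%R /\ invariance_bound w v b]].

Definition JN_bound (w : Y -> R) (p q C : R) : Prop :=
  forall f, Xspace w 1 f -> Xnorm w q f <= C%:E * Xnorm w p f.

Definition JN_property (w : Y -> R) (I : interval R) : Prop :=
  forall p q : R, p \in I -> q \in I -> (p < q)%R ->
    exists2 C : R, (0 < C)%R & JN_bound w p q C.

Definition JN_const (w : Y -> R) (p q : R) : \bar R :=
  ereal_inf [set C%:E | C in [set C : R | (0 < C)%R /\ JN_bound w p q C]].

End oscillation.

(* Main.v *)
Require Import Defs.
From HB Require Import structures.
From mathcomp Require Import all_boot all_order all_algebra.
From mathcomp Require Import all_classical all_reals all_analysis.
From mathcomp Require Import measurable_realfun.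
From mathcomp Require Import ring lra.
Set Implicit Arguments.
Unset Strict Implicit.
Unset Printing Implicit Defensive.
Import Order.TTheory GRing.Theory Num.Theory.
Local Open Scope classical_set_scope.
Local Open Scope ring_scope.
Local Open Scope ereal_scope.

(** Every comparison in the theorem is one and the same transfer between two
weights.  Write <g>_{B,w} for the mean of g on B with respect to w dmu, and <g>_B
for the unweighted mean.  If v is in RH_delta, Hoelder with exponents delta'
and delta gives <L^s>_{B,v} <= [v]_RH <L^(s delta')>_B ^ (1/delta'), so the
weight v disappears; if u is in A_p, Hoelder with exponents p and p' gives
<g>_B <= ([u]_Ap <g^p>_{B,u}) ^ (1/p), so the weight u appears.  Chaining the
two and taking suprema over B yields, in [Xnorm_transfer],
  Xnorm v s f
    <= [v]_RH^(1/s) [u]_Ap^(1/(p delta' s)) Xnorm u (s p delta') f.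

Applied from w0 to w with s = t >= 1, the right-hand side is controlled by
Xnorm w0 1 f through the John-Nirenberg property of w0; t = 1 gives the bound
on b_{w0,w} ([Xnorm_le_forward]).  Applied from w to w0 with
s = 1/(q sigma'), the exponent on the right is exactly 1, so an f in X_w lies
in X_{w0}^s = X_{w0}, and John-Nirenberg between s and 1 gives the bound on
b_{w,w0} ([Xnorm_w0_le_backward]).  The third estimate is the
first transfer with s = t, followed by the comparison of X_{w0} with X_w.

The second application needs the John-Nirenberg property of w0 below exponent
1.  This follows from the property above 1 by interpolation: log-convexity of
the means gives N_1 <= N_p^theta N_2^(1-theta) for p < 1, and since
N_2 <= C N_1 with N_1 finite on X_{w0}, the factor N_1^(1-theta) can be absorbed
([Xnorm_interpolation], [le_absorb]).  The same argument extends to (0, +oo) the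
property obtained for the other weights.

The reverse Hoelder, John-Nirenberg and invariance constants are infima.  The
inequality defining each of them passes to the infimum wherever its right-hand
side is finite ([best_constantP], [RH_const_bound]), so the estimates can be
chained with the infima themselves. *)

Lemma lee_poweR {R : realType} (r : R) (x y : \bar R) :
  (0 <= r)%R -> 0 <= x -> x <= y -> x `^ r <= y `^ r.
Proof.
move=> r0 x0 xy; apply: gt0_ler_poweR => //.
  by rewrite in_itv/= x0 leey.
by rewrite in_itv/= (le_trans x0 xy) leey.
Qed.

(** * Geometric Hoelder inequality and means over a set *)

Section integral_means.
Context {d : measure_display} {Y : measurableType d} {R : realType}.
Variable mu : {measure set Y -> \bar R}.
Implicit Types (B : set Y) (g h u v w : Y -> R) (a : R).

Lemma Lnorm_restrict_powR B g a : (0 < a)%R ->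
  (forall x, (0 <= g x)%R) ->
  Lnorm mu (a^-1)%:E (EFin \o ((fun x => g x `^ a)%R \_ B)) =
  (\int[mu]_(x in B) (g x)%:E) `^ a.
Proof.
move=> a0 g0; rewrite unlock invrK [in RHS]integral_mkcond.
congr (_ `^ _); apply: eq_integral => x _ /=; rewrite /patch.
case: ifPn => _ /=; last first.
  by rewrite normr0 powR0// invr_neq0// gt_eqF.
by rewrite ger0_norm ?powR_ge0// -powRrM mulfV ?gt_eqF// powRr1.
Qed.

(** Hoelder's inequality in its weighted-geometric-mean form: no conjugate
exponents appear, and both integrals may be infinite. *)
Lemma integral_powR_geometric B g h a : measurable B ->
  (forall x, (0 <= g x)%R) -> (forall x, (0 <= h x)%R) ->
  measurable_fun [set: Y] g -> measurable_fun [set: Y] h ->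
  (0 < a < 1)%R ->
  \int[mu]_(x in B) (g x `^ a * h x `^ (1 - a))%:E
    <= (\int[mu]_(x in B) (g x)%:E) `^ a
       * (\int[mu]_(x in B) (h x)%:E) `^ (1 - a).
Proof.
move=> mB g0 h0 mg mh /andP[a0 a1].
have b0 : (0 < 1 - a)%R by rewrite subr_gt0.
have mpow (k : Y -> R) (b : R) : measurable_fun [set: Y] k ->
    measurable_fun [set: Y] ((fun x => k x `^ b)%R \_ B).
  move=> mk; apply/(measurable_restrictT _ mB); apply: measurable_funTS.
  exact: measurableT_comp (measurable_powR b) mk.
have pq : ((a^-1)^-1 + ((1 - a)^-1)^-1 = 1)%R by rewrite !invrK subrKC.
have := hoelder mu (mpow g a mg) (mpow h (1 - a)%R mh) _ _ pq.
rewrite !invr_gt0 !Lnorm_restrict_powR// => /(_ a0 b0); apply: le_trans.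
rewrite Lnorm1 integral_mkcond le_eqVlt; apply/orP; left; apply/eqP.
apply: eq_integral => x _ /=; rewrite /patch.
case: ifPn => _ /=; last by rewrite mulr0 normr0.
by rewrite ger0_norm// mulr_ge0// powR_ge0.
Qed.

(** Both sides of the geometric form are homogeneous of degree one in the
measure, so it survives normalisation; c is the inverse of mu B or of w(B). *)
Lemma scaled_integral_powR_geometric (c : R) B g h a : (0 <= c)%R ->
  measurable B ->
  (forall x, (0 <= g x)%R) -> (forall x, (0 <= h x)%R) ->
  measurable_fun [set: Y] g -> measurable_fun [set: Y] h ->
  (0 < a < 1)%R ->
  \int[mu]_(x in B) (g x `^ a * h x `^ (1 - a))%:E * c%:E
    <= (\int[mu]_(x in B) (g x)%:E * c%:E) `^ a
       * (\int[mu]_(x in B) (h x)%:E * c%:E) `^ (1 - a).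
Proof.
move=> c0 mB g0 h0 mg mh a01.
have int0 (k : Y -> R) : (forall x, 0 <= k x)%R ->
    0 <= \int[mu]_(x in B) (k x)%:E.
  by move=> k0; apply: integral_ge0 => x _; rewrite lee_fin.
rewrite !poweRM ?int0// muleACA -[X in _ <= _ * X]poweRD; last first.
  by apply: add_neq0_poweRD_def; rewrite subrKC oner_neq0.
rewrite subrKC poweRe1// lee_wpmul2r//.
exact: integral_powR_geometric.
Qed.

Lemma measurable_fun_powR g a : measurable_fun [set: Y] g ->
  measurable_fun [set: Y] (fun x => g x `^ a)%R.
Proof. exact: measurableT_comp (measurable_powR a). Qed.

Definition weighted_mean B w g : \bar R :=
  (\int[mu]_(x in B) (g x * w x)%:E) / (\int[mu]_(x in B) (w x)%:E).

Lemma inve_pos_fin (x : \bar R) : 0 < x < +oo ->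
  exists2 c : R, (0 < c)%R & x^-1 = c%:E /\ x = (c^-1)%:E.
Proof.
case: x => [r| |] /andP[]//; rewrite lte_fin => r0 _.
exists r^-1%R; first by rewrite invr_gt0.
by rewrite inver gt_eqF// invrK.
Qed.

Lemma weighted_mean_ge0 B w g : (forall x, 0 <= w x)%R ->
  (forall x, 0 <= g x)%R -> 0 <= weighted_mean B w g.
Proof.
move=> w0 g0; rewrite mule_ge0 ?inve_ge0//; apply: integral_ge0 => x _.
  by rewrite lee_fin mulr_ge0.
by rewrite lee_fin.
Qed.

Lemma average_ge0 B (g : Y -> \bar R) : (forall x, 0 <= g x) ->
  0 <= average mu B g.
Proof.
by move=> g0; rewrite mule_ge0 ?inve_ge0//; exact: integral_ge0.
Qed.

(** Hoelder applied to g^p w and g^r w: the weight keeps exponent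
a + (1 - a) = 1. *)
Lemma weighted_mean_powR_logconvex B w g (p r a : R) : measurable B ->
  (forall x, 0 <= w x)%R -> (forall x, 0 <= g x)%R ->
  measurable_fun [set: Y] w -> measurable_fun [set: Y] g ->
  0 < \int[mu]_(x in B) (w x)%:E < +oo ->
  (0 < a < 1)%R -> (0 < a * p + (1 - a) * r)%R ->
  weighted_mean B w (fun x => g x `^ (a * p + (1 - a) * r))%R
    <= weighted_mean B w (fun x => g x `^ p)%R `^ a
       * weighted_mean B w (fun x => g x `^ r)%R `^ (1 - a).
Proof.
move=> mB w0 g0 mw mg /inve_pos_fin[c c0 [wc _]] a01 s0.
rewrite /weighted_mean wc.
have gw0 (b : R) x : (0 <= g x `^ b * w x)%R by rewrite mulr_ge0// powR_ge0.
have mgw (b : R) : measurable_fun [set: Y] (fun x => g x `^ b * w x)%R.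
  by apply: measurable_funM => //; exact: measurable_fun_powR.
have := scaled_integral_powR_geometric (ltW c0) mB
  (gw0 p) (gw0 r) (mgw p) (mgw r) a01.
apply: le_trans; rewrite le_eqVlt; apply/orP; left; apply/eqP.
congr (_ * _); apply: eq_integral => x _; congr EFin.
have powg b : (0 <= g x `^ b)%R by exact: powR_ge0.
rewrite !powRM// mulrACA -!powRrM (mulrC p) (mulrC r) -powRD; last first.
  by rewrite gt_eqF.
rewrite -[(_ `^ a * _)%R]powRD; last by rewrite subrKC oner_eq0.
by rewrite subrKC powRr1.
Qed.

Lemma weighted_mean1 B w : 0 < \int[mu]_(x in B) (w x)%:E < +oo ->
  weighted_mean B w (fun=> 1%R) = 1.
Proof.
move=> /[dup] /andP[w0 woo] _; rewrite /weighted_mean.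
under eq_integral do rewrite mul1r.
by rewrite divee ?gt_eqF// ge0_fin_numE ?(ltW w0).
Qed.

(** Log-convexity between the exponents q and 0, where the mean of g^0 is 1. *)
Lemma weighted_mean_powR_jensen B w g (p q : R) : measurable B ->
  (forall x, 0 <= w x)%R -> (forall x, 0 <= g x)%R ->
  measurable_fun [set: Y] w -> measurable_fun [set: Y] g ->
  0 < \int[mu]_(x in B) (w x)%:E < +oo -> (0 < p < q)%R ->
  weighted_mean B w (fun x => g x `^ p)%R
    <= weighted_mean B w (fun x => g x `^ q)%R `^ (p / q).
Proof.
move=> mB w0 g0 mw mg wB /andP[p0 pq].
have q0 : (0 < q)%R := lt_trans p0 pq.
have a01 : (0 < p / q < 1)%R by rewrite divr_gt0//= ltr_pdivrMr// mul1r.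
have pE : (p / q * q + (1 - p / q) * 0)%R = p.
  by rewrite mulr0 addr0 divfK// gt_eqF.
have := weighted_mean_powR_logconvex mB w0 g0 mw mg wB a01.
move=> /(_ q 0%R); rewrite pE => /(_ p0).
have -> : (fun x => g x `^ 0)%R = (fun=> 1%R).
  by apply/funext => x; rewrite powRr0.
by rewrite weighted_mean1// poweR1r mule1.
Qed.

(** * Passing between weighted and unweighted means *)

(** The reverse Hoelder inequality removes a weight: Hoelder splits g^s v into
g^(s delta') and v^delta, and the mean of v^delta is at most D times the mean
of v, which is the normalising factor of the weighted mean. *)
Lemma average_transfer_RH B v g (delta s : R) (D : R) : measurable B ->
  0 < mu B < +oo ->
  (forall x, 0 <= v x)%R -> (forall x, 0 <= g x)%R ->
  measurable_fun [set: Y] v -> measurable_fun [set: Y] g ->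
  0 < \int[mu]_(x in B) (v x)%:E < +oo -> (1 < delta)%R ->
  (average mu B (fun x => (v x `^ delta)%R%:E)) `^ delta^-1
      <= D%:E * average mu B (EFin \o v) ->
  weighted_mean B v (fun x => g x `^ s)%R <=
  (average mu B (fun x => (g x `^ (s * conj_exp delta))%R%:E))
    `^ (conj_exp delta)^-1 * D%:E.
Proof.
move=> mB Bfin v0 g0 mv mg vB d1.
have d0 : (0 < delta)%R := lt_trans ltr01 d1.
have dV : ((conj_exp delta)^-1 = 1 - delta^-1)%R.
  by rewrite /conj_exp invf_div mulrBl mul1r mulfV ?gt_eqF.
have dV01 : (0 < 1 - delta^-1 < 1)%R.
  by rewrite subr_gt0 invf_lt1// d1 ltrBlDr ltrDl invr_gt0.
have dp0 : (0 < (conj_exp delta)^-1)%R by rewrite dV; case/andP: dV01.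
have dp0' : (0 < conj_exp delta)%R by rewrite -invr_gt0.
rewrite /weighted_mean /average.
have [c c0 [-> _]] := inve_pos_fin Bfin.
have [k k0 [-> vE]] := inve_pos_fin vB.
rewrite [X in _ <= _ * (X * _) -> _]vE => RH.
have pow0 (h : Y -> R) (b : R) x : (0 <= h x `^ b)%R by exact: powR_ge0.
have := scaled_integral_powR_geometric (ltW c0) mB (pow0 g _) (pow0 v _)
  (measurable_fun_powR (s * conj_exp delta) mg) (measurable_fun_powR delta mv)
  dV01.
rewrite -dV (_ : 1 - (conj_exp delta)^-1 = delta^-1)%R; last by rewrite dV subKr.
rewrite (_ : \int[mu]_(x in B) _ = \int[mu]_(x in B) (g x `^ s * v x)%:E); last first.
  apply: eq_integral => x _; rewrite -!powRrM mulfK ?mulfV ?powRr1 ?gt_eqF//.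
move=> /le_trans/(_ (lee_wpmul2l (poweR_ge0 _ _) RH)) H.
have kc0 : 0 <= (k / c)%:E :> \bar R by rewrite lee_fin divr_ge0// ltW.
move: (lee_wpmul2r kc0 H); rewrite -!muleA -!EFinM.
have -> : (c * (k / c) = k)%R by field; rewrite gt_eqF.
by rewrite mulVf ?mulr1// gt_eqF.
Qed.

Lemma neg_powE w (s : R) x : (forall x, 0 <= w x)%R -> (0 < s)%R ->
  neg_pow w s x = if w x == 0%R then +oo else (w x `^ (- s))%R%:E.
Proof.
move=> w0 s0; rewrite /neg_pow inver powR_eq0 (gt_eqF s0) andbT.
by case: ifPn => // wx0; rewrite powRN.
Qed.

Lemma neg_pow_ge0 w (s : R) x : 0 <= neg_pow w s x.
Proof. by rewrite /neg_pow inve_ge0 lee_fin powR_ge0. Qed.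

Lemma measurable_neg_pow w (s : R) : (forall x, 0 <= w x)%R -> (0 < s)%R ->
  measurable_fun [set: Y] w -> measurable_fun [set: Y] (neg_pow w s).
Proof.
move=> w0 s0 mw; rewrite (_ : neg_pow w s = fun x => if w x == 0%R then +oo else
  (w x `^ (- s))%R%:E); last by apply/funext => x; exact: neg_powE.
apply: measurable_fun_ifT => //.
  by apply: measurable_fun_eqr => //.
by apply/measurable_EFinP; exact: measurable_fun_powR.
Qed.

Lemma measurable_zeros w B : measurable B -> measurable_fun [set: Y] w ->
  measurable (B `&` [set x | w x = 0%R]).
Proof.
move=> mB mw; apply: measurableI => //; rewrite -[X in measurable X]setTI.
exact: mw measurableT _ (measurable_set1 0%R).
Qed.

(** The negative power is +oo on the zeros of w, so it cannot be integrable
unless they form a null set. *)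
Lemma neg_pow_integral_null_zeros B w (s : R) : measurable B ->
  (forall x, 0 <= w x)%R -> measurable_fun [set: Y] w -> (0 < s)%R ->
  \int[mu]_(x in B) neg_pow w s x < +oo ->
  mu (B `&` [set x | w x = 0%R]) = 0.
Proof.
move=> mB w0 mw s0 fin; apply/eqP; apply: contraTT fin => N0.
have mN := measurable_zeros mB mw.
rewrite -leNgt leye_eq -leye_eq.
have <- : \int[mu]_(x in B `&` [set x | w x = 0%R]) neg_pow w s x = +oo.
  rewrite (eq_integral (cst +oo)); last first.
    by move=> x /[!inE] -[_ /= wx]; rewrite neg_powE// wx eqxx.
  by rewrite integral_cst// gt0_mulye// lt0e N0 measure_ge0.
apply: ge0_subset_integral => //.
  exact/measurable_funTS/measurable_neg_pow.
by move=> x _; exact: neg_pow_ge0.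
Qed.

Lemma integral_weight_gt0 B w : measurable B -> 0 < mu B ->
  (forall x, 0 <= w x)%R -> measurable_fun [set: Y] w ->
  mu (B `&` [set x | w x = 0%R]) = 0 ->
  0 < \int[mu]_(x in B) (w x)%:E.
Proof.
move=> mB B0 w0 mw N0.
rewrite lt_neqAle integral_ge0 ?andbT => [|x _]; last by rewrite lee_fin.
apply/eqP => I0.
have mN := measurable_zeros mB mw.
have mw' : measurable_fun B (EFin \o w) by exact/measurable_funTS/measurable_EFinP.
have /(ae_eq_integral_abs mu mB mw')[M [mM M0 BM]] :
    \int[mu]_(x in B) `|(EFin \o w) x| = 0.
  by rewrite I0; apply: eq_integral => x _ /=; rewrite ger0_norm.
have BNM : B `<=` (B `&` [set x | w x = 0%R]) `|` M.
  move=> x Bx; have [wx|wx] := eqVneq (w x) 0%R; [by left|right].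
  by apply: BM => /(_ Bx)[] /eqP; rewrite (negPf wx).
move: B0; rewrite lt0e => /andP[/eqP + _]; apply; apply/eqP.
rewrite eq_le measure_ge0 andbT.
have := le_measure mu (mem_set mB) (mem_set (measurableU _ _ mN mM)) BNM.
move=> /le_trans; apply; apply: le_trans (measureU2 _ mN mM) _.
by rewrite [X in X + _]N0 [X in _ + X]M0 adde0.
Qed.

(** The A_p condition introduces a weight: write g = (g^p u)^(1/p) u^(-1/p)
outside the null set where u vanishes, and apply Hoelder.  The two averages of
u and of its negative power assemble into the A_p product. *)
Lemma average_transfer_Ap B u g (p : R) : measurable B ->
  0 < mu B < +oo -> (1 < p)%R ->
  (forall x, 0 <= u x)%R -> (forall x, 0 <= g x)%R ->
  measurable_fun [set: Y] u -> measurable_fun [set: Y] g ->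
  0 < \int[mu]_(x in B) (u x)%:E < +oo ->
  mu (B `&` [set x | u x = 0%R]) = 0 ->
  average mu B (EFin \o g) <=
    (weighted_mean B u (fun x => g x `^ p)%R *
     (average mu B (EFin \o u) *
      average mu B (neg_pow u (conj_exp p / p)) `^ (p / conj_exp p))) `^ p^-1.
Proof.
move=> mB Bfin p1 u0 g0 mu_ mg uB N0.
have p0 : (0 < p)%R := lt_trans ltr01 p1.
have p10 : (0 < p - 1)%R by rewrite subr_gt0.
have -> : (conj_exp p / p = (p - 1)^-1)%R.
  by rewrite /conj_exp; field; rewrite !gt_eqF.
have -> : (p / conj_exp p = p - 1)%R.
  by rewrite /conj_exp; field; rewrite !gt_eqF.
have s0 : (0 < (p - 1)^-1)%R by rewrite invr_gt0.
have a01 : (0 < p^-1 < 1)%R by rewrite invr_gt0 p0 invf_lt1.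
(* h is 0, not +oo, where u vanishes; this is harmless on a null set. *)
pose h x := (u x `^ (- (p - 1)^-1))%R.
have mh : measurable_fun [set: Y] h by exact: measurable_fun_powR.
have h0 x : (0 <= h x)%R by exact: powR_ge0.
have mG : measurable_fun [set: Y] (fun x => g x `^ p * u x)%R.
  by apply: measurable_funM => //; exact: measurable_fun_powR.
have G0 x : (0 <= g x `^ p * u x)%R by rewrite mulr_ge0// powR_ge0.
rewrite /weighted_mean /average.
have [c c0 [-> _]] := inve_pos_fin Bfin.
have [k k0 [-> uE]] := inve_pos_fin uB.
have ce0 : 0 <= c%:E :> \bar R by rewrite lee_fin ltW.
have mN := measurable_zeros mB mu_.
have -> : \int[mu]_(x in B) (EFin \o g) x =
    \int[mu]_(x in B) ((g x `^ p * u x) `^ p^-1 * h x `^ (1 - p^-1))%:E.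
  have m1 : measurable_fun B (EFin \o g).
    exact/measurable_funTS/measurable_EFinP.
  rewrite (ge0_negligible_integral mN mB m1) => [||//]; last first.
    by move=> x _; rewrite lee_fin.
  rewrite [RHS](ge0_negligible_integral mN mB) => [||x _|//]; last first.
  - by rewrite lee_fin mulr_ge0// powR_ge0.
  - apply/measurable_funTS/measurable_EFinP.
    by apply: measurable_funM; exact: measurable_fun_powR.
  apply: eq_integral => x /[!inE] -[Bx /not_andP[//|/eqP ux]]; congr EFin.
  rewrite powRM ?powR_ge0// -!powRrM mulfV ?gt_eqF// powRr1// -mulrA -powRD.
    rewrite (_ : (_ + _)%R = 0%R) ?powRr0 ?mulr1//.
    by field; rewrite !gt_eqF.
  by rewrite ux implybT.
have hN : \int[mu]_(x in B) (h x)%:E <= \int[mu]_(x in B) neg_pow u (p - 1)^-1 x.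
  apply: ge0_le_integral => //.
  - by move=> x _; rewrite lee_fin.
  - exact/measurable_funTS/measurable_EFinP.
  - exact/measurable_funTS/measurable_neg_pow.
  - by move=> x _; rewrite neg_powE//; case: ifP => _; rewrite ?leey.
apply: le_trans (scaled_integral_powR_geometric (ltW c0) mB G0 h0 mG mh a01) _.
have IG0 : 0 <= \int[mu]_(x in B) (g x `^ p * u x)%:E.
  by apply: integral_ge0 => x _; rewrite lee_fin.
have Ih0 : 0 <= \int[mu]_(x in B) (h x)%:E.
  by apply: integral_ge0 => x _; rewrite lee_fin.
set X := _ `^ (p - 1).
have -> : \int[mu]_(x in B) (EFin \o u) x = k^-1%:E by exact: uE.
rewrite (_ : _ * k%:E * _ = \int[mu]_(x in B) (g x `^ p * u x)%:E * c%:E * X);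
  last by rewrite !muleA -(muleA _ k%:E) -EFinM mulfV ?gt_eqF// mule1.
rewrite [in leRHS]poweRM ?poweR_ge0 ?mule_ge0// /X -poweRrM.
rewrite (_ : (p - 1) * p^-1 = 1 - p^-1)%R; last by field; rewrite gt_eqF.
rewrite lee_wpmul2l ?poweR_ge0//.
apply: lee_poweR; rewrite ?mule_ge0//.
  by case/andP: a01 => _ /ltW; rewrite subr_ge0.
exact: lee_wpmul2r.
Qed.
End integral_means.

(** * Suprema and best constants *)

Section suprema_and_best_constants.
Context {R : realType}.

Lemma nnsup_ge0 T (A : set T) (G : T -> \bar R) : 0 <= nnsup A G.
Proof. by apply: ereal_sup_ubound; left. Qed.

Lemma nnsup_ub T (A : set T) (G : T -> \bar R) x : A x -> G x <= nnsup A G.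
Proof. by move=> Ax; apply: ereal_sup_ubound; right; exists x. Qed.

Lemma nnsup_le T (A : set T) (G : T -> \bar R) M : 0 <= M ->
  (forall x, A x -> G x <= M) -> nnsup A G <= M.
Proof.
move=> M0 GM; apply: ge_ereal_sup => _ [->//|[x Ax <-]]; exact: GM.
Qed.

Definition best_constant (S : set R) : \bar R := ereal_inf [set C%:E | C in S].

Lemma best_constant_fin (S : set R) : S !=set0 -> (forall C, S C -> (0 <= C)%R) ->
  exists2 c : R, (0 <= c)%R & best_constant S = c%:E.
Proof.
move=> [C SC] S0.
have inf0 : 0 <= best_constant S.
  by apply: le_ereal_inf_tmp => _ [c Sc <-]; rewrite lee_fin S0.
have inf_fin : best_constant S \is a fin_num.
  rewrite ge0_fin_numE//; apply: le_lt_trans (ltry C).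
  by apply: ereal_inf_lbound; exists C.
exists (fine (best_constant S)); last by rewrite fineK.
by rewrite fine_ge0.
Qed.

(** Dividing by y turns the family of inequalities into a lower bound of the
infimum.  For y = +oo the conclusion can fail: the infimum may be 0, and
0 * +oo = 0. *)
Lemma best_constant_attained (S : set R) (x y : \bar R) : S !=set0 ->
  (forall C, S C -> (0 <= C)%R) -> 0 <= y < +oo ->
  (forall C, S C -> x <= C%:E * y) -> x <= best_constant S * y.
Proof.
case: y => [r| |] Sn S0 /andP[]//; rewrite lee_fin le_eqVlt => /orP[/eqP<- _|r0 _].
  by case: Sn => C SC /(_ C SC); rewrite !mule0.
move=> xS; rewrite -lee_pdivrMr//; apply: le_ereal_inf_tmp => _ [C SC <-].
by rewrite lee_pdivrMr// xS.
Qed.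

Lemma real_constant T (P : set T) (N1 N2 : T -> \bar R) (K : \bar R) :
  0 <= K < +oo -> (forall f, 0 <= N2 f) ->
  (forall f, P f -> N1 f <= K * N2 f) ->
  exists2 C : R, (0 < C)%R & forall f, P f -> N1 f <= C%:E * N2 f.
Proof.
case: K => [k| |] /andP[]//; rewrite lee_fin => k0 _ N20 H.
exists (k + 1)%R; first by rewrite ltr_wpDl.
move=> f Pf; apply: le_trans (H f Pf) _.
by rewrite lee_wpmul2r// lee_fin lerDl.
Qed.

(** K itself may be 0 while admissible constants are positive, hence the passage
through k + e. *)
Lemma best_constant_le T (P : set T) (N1 N2 : T -> \bar R) (K : \bar R) :
  0 <= K -> (forall f, 0 <= N2 f) ->
  (forall f, P f -> N1 f <= K * N2 f) ->
  best_constant [set C : R | (0 < C)%R /\ forall f, P f -> N1 f <= C%:E * N2 f]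
    <= K.
Proof.
case: K => [k| |]//; rewrite ?leey// lee_fin => k0 N20 H.
apply/lee_addgt0Pr => e e0; apply: ereal_inf_lbound; exists (k + e)%R => //.
split; first by rewrite ltr_wpDl.
move=> f Pf; apply: le_trans (H f Pf) _.
by rewrite lee_wpmul2r// lee_fin lerDl ltW.
Qed.

Lemma best_constantP T (P : set T) (N1 N2 : T -> \bar R) f :
  (exists2 C : R, (0 < C)%R & forall f, P f -> N1 f <= C%:E * N2 f) ->
  P f -> 0 <= N2 f < +oo ->
  N1 f <= best_constant
    [set C : R | (0 < C)%R /\ forall f, P f -> N1 f <= C%:E * N2 f] * N2 f.
Proof.
move=> [C0 C00 HC0] Pf N2f; apply: best_constant_attained => //.
- by exists C0.
- by move=> C [/ltW].
- by move=> C [_]; apply.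
Qed.

Lemma best_constant_bounds T (P : set T) (N1 N2 : T -> \bar R) :
  (exists2 C : R, (0 < C)%R & forall f, P f -> N1 f <= C%:E * N2 f) ->
  0 <= best_constant
    [set C : R | (0 < C)%R /\ forall f, P f -> N1 f <= C%:E * N2 f] < +oo.
Proof.
move=> [C C0 HC]; case: (@best_constant_fin
  [set C : R | (0 < C)%R /\ forall f, P f -> N1 f <= C%:E * N2 f]).
- by exists C.
- by move=> c [/ltW].
- by move=> c c0 ->; rewrite lee_fin c0 ltry.
Qed.

(** A self-improving inequality: dividing by x^(1 - theta) is possible because x
is finite. *)
Lemma le_absorb (theta : R) (C x y : \bar R) : (0 < theta < 1)%R ->
  0 <= C -> 0 <= x < +oo -> 0 <= y ->
  x <= y `^ theta * (C * x) `^ (1 - theta) ->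
  x <= C `^ ((1 - theta) / theta) * y.
Proof.
move=> /andP[t0 t1] C0 + y0; have t10 : (0 < 1 - theta)%R by rewrite subr_gt0.
case: x => [x| |] /andP[]//; rewrite lee_fin le_eqVlt => /orP[/eqP<- _ _|x0 _].
  by rewrite mule_ge0// poweR_ge0.
have xe0 : 0 <= x%:E :> \bar R by rewrite lee_fin ltW.
rewrite (poweRM _ C0 xe0) muleA /= -lee_pdivrMr ?powR_gt0//.
rewrite -powRN -EFinM -{1}(powRr1 (ltW x0)) -powRD; last by rewrite (gt_eqF x0) implybT.
rewrite subKr -poweR_EFin => H.
have tV0 : (0 <= theta^-1)%R by rewrite invr_ge0 ltW.
have := lee_poweR tV0 (poweR_ge0 _ _) H.
rewrite poweRM ?poweR_ge0// -!poweRrM divff ?gt_eqF// !poweRe1//.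
by rewrite muleC.
Qed.

End suprema_and_best_constants.

(** * Comparison of oscillation norms for two weights *)

Section transfer.
Context {d : measure_display} {Y : measurableType d} {R : realType}.
Variables (mu : {measure set Y -> \bar R}) (BB : set (set Y)).
Context {F : Type}.
Variable Lam : F -> set Y -> Y -> R.
Context (BB_measurable : forall B, BB B -> measurable B)
  (BB_measure : forall B, BB B -> 0 < mu B < +oo)
  (Lam_ge0 : forall f B, BB B -> forall x, (0 <= Lam f B x)%R)
  (Lam_measurable : forall f B, BB B -> measurable_fun [set: Y] (Lam f B)).
Implicit Types (u v w : Y -> R) (p q r s t : R) (f : F).

(** What the A_p condition leaves of w for the purpose of weighted means, for any
p: the quotient by w(B) is a genuine division. *)
Definition positive_weight w :=
  [/\ forall x, (0 <= w x)%R, measurable_fun [set: Y] w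
    & forall B, BB B -> 0 < \int[mu]_(x in B) (w x)%:E < +oo].

Lemma Ap_zeros_null p w B : (1 < p)%R -> Ap mu BB p w -> BB B ->
  mu (B `&` [set x | w x = 0%R]) = 0.
Proof.
move=> p1 [w0 [mw _] fin _] BBB.
have s0 : (0 < conj_exp p / p)%R.
  by rewrite !divr_gt0 ?subr_gt0// (lt_trans ltr01).
apply: (neg_pow_integral_null_zeros (BB_measurable BBB) w0 mw s0).
have [c c0 [cE _]] := inve_pos_fin (BB_measure BBB).
have := fin B BBB; rewrite /average cE -(invrK c) lte_pdivrMr ?invr_gt0//.
by rewrite gt0_mulye// lte_fin invr_gt0.
Qed.

Lemma Ap_positive_weight p w : (1 < p)%R -> Ap mu BB p w -> positive_weight w.
Proof.
move=> p1 Aw; have [w0 [mw iw] _ _] := Aw; split=> // B BBB.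
have mB := BB_measurable BBB; apply/andP; split.
  apply: integral_weight_gt0 => //; last exact: Ap_zeros_null p1 Aw BBB.
  by have /andP[] := BB_measure BBB.
exact: integrable_lty (iw B BBB).
Qed.

Lemma Ainfty_positive_weight w : Ainfty mu BB w -> positive_weight w.
Proof. by case=> p p1; exact: Ap_positive_weight. Qed.

Lemma XnormE w p f : Xnorm mu BB Lam w p f =
  nnsup BB (fun B => weighted_mean mu B w (fun x => Lam f B x `^ p)%R) `^ p^-1.
Proof. by []. Qed.

Lemma Xnorm_ge0 w p f : 0 <= Xnorm mu BB Lam w p f.
Proof. exact: poweR_ge0. Qed.


Let meas_pow f B s : BB B -> measurable_fun [set: Y] (fun x => Lam f B x `^ s)%R.
Proof. by move=> BBB; apply: measurable_fun_powR; exact: Lam_measurable. Qed.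

Let pow_ge0 f B s x : (0 <= Lam f B x `^ s)%R.
Proof. exact: powR_ge0. Qed.

Lemma Xnorm_transfer_bound u v p s (delta D : R) f :
  (1 < p)%R -> (1 < delta)%R -> (0 < s)%R ->
  Ap mu BB p u -> positive_weight v -> (0 <= D)%R -> RH_bound mu BB delta v D ->
  Xnorm mu BB Lam v s f <=
    D%:E `^ s^-1 * Ap_const mu BB p u `^ (p * conj_exp delta * s)^-1
    * Xnorm mu BB Lam u (s * p * conj_exp delta) f.
Proof.
move=> p1 d1 s0 Au [v0 mv vB] D0 RHv.
have [u0 mu_ uB] := Ap_positive_weight p1 Au.
have p0 : (0 < p)%R := lt_trans ltr01 p1.
have dp0 : (0 < conj_exp delta)%R.
  by rewrite divr_gt0 ?subr_gt0// (lt_trans ltr01).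
rewrite !XnormE; set S := (X in _ <= _ * (X `^ _)); set A := Ap_const _ _ _ _.
have S0 : 0 <= S := nnsup_ge0 _ _.
have A0 : 0 <= A := nnsup_ge0 _ _.
have De0 : 0 <= D%:E by rewrite lee_fin.
have SA0 : 0 <= (S * A) `^ p^-1 `^ (conj_exp delta)^-1 by exact: poweR_ge0.
have sV0 : (0 <= s^-1)%R by rewrite invr_ge0 ltW.
apply: (@le_trans _ _ (((S * A) `^ p^-1 `^ (conj_exp delta)^-1 * D%:E) `^ s^-1)).
  apply: lee_poweR; [exact: sV0|exact: nnsup_ge0|].
  apply: nnsup_le => [|B BBB]; first by rewrite mule_ge0.
  have mB := BB_measurable BBB; have Bfin := BB_measure BBB.
  apply: le_trans (average_transfer_RH s mB Bfin v0 (Lam_ge0 f BBB) mv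
    (Lam_measurable f BBB) (vB B BBB) d1 (RHv B BBB)) _.
  rewrite lee_wpmul2r//; apply: lee_poweR.
  - by rewrite invr_ge0 ltW.
  - by apply: average_ge0 => x; rewrite lee_fin.
  have W0 : 0 <= weighted_mean mu B u
      (fun x => (Lam f B x `^ (s * conj_exp delta)) `^ p)%R.
    by apply: weighted_mean_ge0 => // x; exact: powR_ge0.
  have N0 : 0 <= average mu B (EFin \o u) *
      average mu B (neg_pow u (conj_exp p / p)) `^ (p / conj_exp p).
    rewrite mule_ge0 ?poweR_ge0//.
    by apply: average_ge0 => x; rewrite lee_fin.
  apply: le_trans (average_transfer_Ap mB Bfin p1 u0
    (pow_ge0 f B (s * conj_exp delta)) mu_
    (meas_pow f (s * conj_exp delta) BBB) (uB B BBB)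
    (Ap_zeros_null p1 Au BBB)) _.
  apply: lee_poweR; first by rewrite invr_ge0 ltW.
    exact: mule_ge0.
  apply: lee_pmul => //.
  - rewrite (_ : (fun x => _) = fun x => Lam f B x `^ (s * p * conj_exp delta))%R.
      exact: (@nnsup_ub _ _ _ (fun B => weighted_mean mu B u _)).
    by apply/funext => x; rewrite -powRrM mulrAC.
  - exact: nnsup_ub BBB.
rewrite poweRM// -!poweRrM; set e := (X in (S * A) `^ X).
have -> : e = (s * p * conj_exp delta)^-1%R by rewrite /e; field; rewrite !gt_eqF.
rewrite poweRM//.
rewrite (_ : s * p * conj_exp delta = p * conj_exp delta * s)%R; last by ring.
by rewrite muleC (muleC (S `^ _)) muleA.
Qed.

Lemma RH_const_bound v (delta : R) : RH mu BB delta v ->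
  exists2 D : R, (0 <= D)%R &
    RH_const mu BB delta v = D%:E /\ RH_bound mu BB delta v D.
Proof.
move=> [Av [D0 D00 HD0]]; have [v0 mv vB] := Ainfty_positive_weight Av.
have Sn : [set C : R | (0 <= C)%R /\ RH_bound mu BB delta v C] !=set0.
  by exists D0.
have [D Dge0 DE] := best_constant_fin Sn (fun _ => @proj1 _ _).
exists D => //; split=> // B BBB; rewrite -DE; apply: best_constant_attained => //.
- by move=> C [].
- rewrite average_ge0 => [|x]; last by rewrite lee_fin.
  have [c c0 [cE _]] := inve_pos_fin (BB_measure BBB).
  have [k k0 [_ vE]] := inve_pos_fin (vB B BBB).
  by rewrite /average cE [X in X * _]vE -EFinM ltry.
- by move=> C [_]; apply.
Qed.

(** The common source of all three quantitative estimates. *)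
Lemma Xnorm_transfer u v p s (delta : R) f :
  (1 < p)%R -> (1 < delta)%R -> (0 < s)%R ->
  Ap mu BB p u -> RH mu BB delta v ->
  Xnorm mu BB Lam v s f <=
    RH_const mu BB delta v `^ s^-1
    * Ap_const mu BB p u `^ (p * conj_exp delta * s)^-1
    * Xnorm mu BB Lam u (s * p * conj_exp delta) f.
Proof.
move=> p1 d1 s0 Au RHv; have [D D0 [-> RHD]] := RH_const_bound RHv.
apply: Xnorm_transfer_bound => //; apply: Ainfty_positive_weight.
by case: RHv.
Qed.

Lemma Xnorm_le_exponent w p q f : positive_weight w -> (0 < p <= q)%R ->
  Xnorm mu BB Lam w p f <= Xnorm mu BB Lam w q f.
Proof.
move=> [w0 mw wB] /andP[p0]; rewrite le_eqVlt => /predU1P[<-//|pq].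
have q0 : (0 < q)%R := lt_trans p0 pq.
rewrite !XnormE; set S := (X in _ <= X `^ _).
have <- : (p / q / p = q^-1)%R by field; rewrite !gt_eqF.
rewrite [leRHS](poweRrM S (p / q) p^-1).
apply: lee_poweR; [by rewrite invr_ge0 ltW|exact: nnsup_ge0|].
apply: nnsup_le => [|B BBB]; first exact: poweR_ge0.
apply: le_trans (weighted_mean_powR_jensen (q := q) (BB_measurable BBB) w0
  (Lam_ge0 f BBB) mw (Lam_measurable f BBB) (wB B BBB) _) _.
  by rewrite p0.
apply: lee_poweR; first by rewrite divr_ge0// ltW.
  by apply: weighted_mean_ge0 => // x; exact: powR_ge0.
exact: (@nnsup_ub _ _ _ (fun B => weighted_mean mu B w _)).
Qed.

(** Writing 1 = a p + (1 - a) 2 forces a = 1/(2 - p), and the norms then carry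
the exponents p a and 2 (1 - a) = 1 - p a. *)
Lemma Xnorm_interpolation w p f : positive_weight w -> (0 < p < 1)%R ->
  Xnorm mu BB Lam w 1 f <= Xnorm mu BB Lam w p f `^ (p / (2 - p))
    * Xnorm mu BB Lam w 2 f `^ (1 - p / (2 - p)).
Proof.
move=> [w0 mw wB] /andP[p0 p1].
have p20 : (0 < 2 - p)%R by lra.
have a01 : (0 < (2 - p)^-1 < 1)%R by rewrite invr_gt0 p20 invf_lt1//; lra.
have sE : ((2 - p)^-1 * p + (1 - (2 - p)^-1) * 2 = 1)%R.
  by field; rewrite gt_eqF.
pose S s := nnsup BB
  (fun B => weighted_mean mu B w (fun x => Lam f B x `^ s)%R).
have S0 s : 0 <= S s := nnsup_ge0 _ _.
have -> : Xnorm mu BB Lam w 1 f = S 1%R.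
  by rewrite XnormE invr1; exact: (poweRe1 (S0 1%R)).
have XE s b : Xnorm mu BB Lam w s f `^ b = S s `^ (s^-1 * b).
  by symmetry; exact: poweRrM.
rewrite !XE.
have -> : (p^-1 * (p / (2 - p)) = (2 - p)^-1)%R.
  by field; rewrite !gt_eqF.
have -> : (2^-1 * (1 - p / (2 - p)) = 1 - (2 - p)^-1)%R.
  by field; rewrite gt_eqF.
apply: nnsup_le => [|B BBB]; first by rewrite mule_ge0// poweR_ge0.
have := weighted_mean_powR_logconvex (p := p) (r := 2) (BB_measurable BBB) w0
  (Lam_ge0 f BBB) mw (Lam_measurable f BBB) (wB B BBB) a01.
rewrite sE => /(_ ltr01)/le_trans; apply.
have wm0 s : 0 <= weighted_mean mu B w (fun x => Lam f B x `^ s)%R.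
  by apply: weighted_mean_ge0 => // x; exact: powR_ge0.
apply: lee_pmul; rewrite ?poweR_ge0//; apply: lee_poweR => //.
- by case/andP: a01 => /ltW.
- exact: (@nnsup_ub _ _ _ (fun B => weighted_mean mu B w _)).
- by case/andP: a01 => _ /ltW; rewrite subr_ge0.
- exact: (@nnsup_ub _ _ _ (fun B => weighted_mean mu B w _)).
Qed.

(** For p < 1 the interpolation inequality becomes N_1 <= N_p^theta (C N_1)^(1-theta)
with theta = p/(2 - p), and N_1 is absorbed because it is finite on X_w. *)
Lemma JN_bound_to_one w p : positive_weight w -> (0 < p)%R ->
  (exists2 C : R, (0 < C)%R & JN_bound mu BB Lam w 1 2 C) ->
  exists2 C : R, (0 < C)%R & JN_bound mu BB Lam w p 1 C.
Proof.
move=> pw p0 [C C0 HC]; have [p1|p1] := leP 1%R p.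
  exists 1%R => // f _; rewrite mul1e; apply: Xnorm_le_exponent => //.
  by rewrite ltr01.
have th01 : (0 < p / (2 - p) < 1)%R.
  by rewrite divr_gt0 ?ltr_pdivrMr; lra.
pose K := C%:E `^ ((1 - p / (2 - p)) / (p / (2 - p))).
apply: (@real_constant _ _ _ _ _ K).
- by rewrite poweR_ge0 poweR_lty// ltry.
- by move=> f; exact: Xnorm_ge0.
move=> f Xf; apply: le_absorb => //; rewrite ?Xnorm_ge0//.
  by rewrite lee_fin ltW.
apply: le_trans (@Xnorm_interpolation w p f pw _) _; first by apply/andP; split.
apply: lee_wpmul2l; first exact: poweR_ge0.
apply: lee_poweR; [by case/andP: th01 => _ /ltW; rewrite subr_ge0
                  |exact: Xnorm_ge0|exact: HC].
Qed.

(** Exponent 1 serves as a pivot: N_q <= C N_1 from the hypothesis or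
monotonicity, N_1 <= C N_p from absorption or monotonicity. *)
Lemma JN_property_from_one w : positive_weight w ->
  (forall t, (1 < t)%R ->
    exists2 C : R, (0 < C)%R & JN_bound mu BB Lam w 1 t C) ->
  JN_property mu BB Lam w `]0%R, +oo[.
Proof.
move=> pw JN p q; rewrite !in_itv/= !andbT => p0 q0 _.
have [C1 C10 HC1] : exists2 C : R, (0 < C)%R & JN_bound mu BB Lam w 1 q C.
  have [q1|/JN//] := leP q 1%R.
  exists 1%R => // f _; rewrite mul1e; apply: Xnorm_le_exponent => //.
  by rewrite q0.
have lt12 : (1 < 2 :> R)%R by lra.
have [C2 C20 HC2] := JN_bound_to_one pw p0 (JN _ lt12).
exists (C1 * C2)%R; first exact: mulr_gt0.
move=> f Xf; apply: le_trans (HC1 f Xf) _; rewrite EFinM -muleA.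
by apply: lee_wpmul2l; [rewrite lee_fin ltW|exact: HC2].
Qed.

End transfer.

Lemma conj_exp_gt1 {R : realType} (p : R) : (1 < p)%R -> (1 < conj_exp p)%R.
Proof. by move=> p1; rewrite /conj_exp ltr_pdivlMr ?subr_gt0//; lra. Qed.

(** * Comparison with a reference weight *)

Section comparison.
Context {d : measure_display} {Y : measurableType d} {R : realType}.
Variables (mu : {measure set Y -> \bar R}) (BB : set (set Y)).
Context {F : Type}.
Variables (Lam : F -> set Y -> Y -> R) (w0 : Y -> R).
Context (BB_measurable : forall B, BB B -> measurable B)
  (BB_measure : forall B, BB B -> 0 < mu B < +oo)
  (Lam_ge0 : forall f B, BB B -> forall x, (0 <= Lam f B x)%R)
  (Lam_measurable : forall f B, BB B -> measurable_fun [set: Y] (Lam f B))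
  (JN0 : JN_property mu BB Lam w0 `]0%R, +oo[)
  (w0_small : forall p : R, (0 < p < 1)%R ->
     Xspace mu BB Lam w0 p = Xspace mu BB Lam w0 1).
Implicit Types (w : Y -> R) (p q t : R) (f : F).

Let JN0_bound p q : (0 < p < q)%R ->
  exists2 C : R, (0 < C)%R & JN_bound mu BB Lam w0 p q C.
Proof.
move=> /andP[p0 pq]; apply: JN0 => //; rewrite in_itv/= andbT//.
exact: lt_trans p0 pq.
Qed.

Lemma Xnorm_JN_const p q f : (0 < p < q)%R -> Xspace mu BB Lam w0 1 f ->
  Xnorm mu BB Lam w0 p f < +oo ->
  Xnorm mu BB Lam w0 q f
    <= JN_const mu BB Lam w0 p q * Xnorm mu BB Lam w0 p f.
Proof.
move=> pq Xf fin; apply: (best_constantP (JN0_bound pq) Xf).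
by rewrite Xnorm_ge0.
Qed.

Lemma JN_const_fin p q : (0 < p < q)%R -> 0 <= JN_const mu BB Lam w0 p q < +oo.
Proof. by move=> pq; exact: best_constant_bounds (JN0_bound pq). Qed.

Lemma Ap_const_fin p w : Ap mu BB p w -> 0 <= Ap_const mu BB p w < +oo.
Proof. by move=> [_ _ _ ->]; rewrite nnsup_ge0. Qed.

Lemma RH_const_fin (delta : R) w : RH mu BB delta w ->
  0 <= RH_const mu BB delta w < +oo.
Proof.
move=> /(RH_const_bound BB_measurable BB_measure)[D D0 [-> _]].
by rewrite lee_fin D0 ltry.
Qed.

Lemma mule_fin_ge0 (x y : \bar R) : 0 <= x < +oo -> 0 <= y < +oo ->
  0 <= x * y < +oo.
Proof.
move=> /andP[x0 xoo] /andP[y0 yoo]; rewrite mule_ge0//=.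
by apply: lte_mul_pinfty => //; rewrite ge0_fin_numE.
Qed.

Lemma poweR_fin_ge0 (x : \bar R) r : 0 <= x < +oo -> 0 <= x `^ r < +oo.
Proof. by move=> /andP[_ xoo]; rewrite poweR_ge0 poweR_lty. Qed.

(** The bound of Xnorm w t by Xnorm w0 1 obtained from w0 in A_p and w in
RH_delta. *)
Definition forward_const w p t (delta : R) : \bar R :=
  JN_const mu BB Lam w0 1 (t * p * conj_exp delta)
  * Ap_const mu BB p w0 `^ (p * conj_exp delta * t)^-1
  * RH_const mu BB delta w `^ t^-1.

Lemma forward_exponent_gt1 p t (delta : R) :
  (1 < p)%R -> (1 < delta)%R -> (1 <= t)%R ->
  (0 < (1 : R) < t * p * conj_exp delta)%R.
Proof.
move=> p1 /conj_exp_gt1 d1 t1; rewrite ltr01/=.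
by rewrite mulr_egt1// (lt_le_trans p1)// ler_peMl// (le_trans ler01)// ltW.
Qed.

Lemma forward_const_fin w p t (delta : R) :
  (1 < p)%R -> (1 < delta)%R -> (1 <= t)%R ->
  Ap mu BB p w0 -> RH mu BB delta w -> 0 <= forward_const w p t delta < +oo.
Proof.
move=> p1 d1 t1 Aw0 RHw.
apply: mule_fin_ge0; last exact/poweR_fin_ge0/RH_const_fin.
apply: mule_fin_ge0; last exact/poweR_fin_ge0/Ap_const_fin.
exact/JN_const_fin/forward_exponent_gt1.
Qed.

Lemma Xnorm_le_forward w p t (delta : R) f :
  (1 < p)%R -> (1 < delta)%R -> (1 <= t)%R ->
  Ap mu BB p w0 -> RH mu BB delta w -> Xspace mu BB Lam w0 1 f ->
  Xnorm mu BB Lam w t f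
    <= forward_const w p t delta * Xnorm mu BB Lam w0 1 f.
Proof.
move=> p1 d1 t1 Aw0 RHw Xf; have t0 : (0 < t)%R := lt_le_trans ltr01 t1.
apply: le_trans (Xnorm_transfer BB_measurable BB_measure Lam_ge0
  Lam_measurable f p1 d1 t0 Aw0 RHw) _.
have := Xnorm_JN_const (forward_exponent_gt1 p1 d1 t1) Xf Xf.
set M := RH_const _ _ _ _ `^ _ * _; have M0 : 0 <= M.
  by rewrite mule_ge0 ?poweR_ge0.
move=> /(lee_wpmul2l M0)/le_trans; apply.
rewrite muleA lee_wpmul2r ?Xnorm_ge0// /forward_const /M.
by rewrite -muleA (muleC (RH_const _ _ _ _ `^ _)) (muleC (_ `^ _) (JN_const _ _ _ _ _ _)).
Qed.

(** The bound of Xnorm w0 1 by Xnorm w 1 obtained from w in A_q and w0 in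
RH_sigma. *)
Definition backward_const w q (sigma : R) : \bar R :=
  JN_const mu BB Lam w0 (q * conj_exp sigma)^-1 1
  * Ap_const mu BB q w * RH_const mu BB sigma w0 `^ (q * conj_exp sigma).

Lemma backward_exponent_lt1 q (sigma : R) : (1 < q)%R -> (1 < sigma)%R ->
  (0 < (q * conj_exp sigma)^-1 < 1)%R.
Proof.
move=> q1 /conj_exp_gt1 s1.
have qs1 : (1 < q * conj_exp sigma)%R by rewrite mulr_egt1.
by rewrite invr_gt0 invf_lt1 ?qs1 ?(lt_trans ltr01 qs1).
Qed.

Lemma backward_const_fin w q (sigma : R) : (1 < q)%R -> (1 < sigma)%R ->
  Ap mu BB q w -> RH mu BB sigma w0 -> 0 <= backward_const w q sigma < +oo.
Proof.
move=> q1 s1 Aw RHw0.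
apply: mule_fin_ge0; last exact/poweR_fin_ge0/RH_const_fin.
apply: mule_fin_ge0; last exact: Ap_const_fin.
exact/JN_const_fin/backward_exponent_lt1.
Qed.

(** Transfer from w to w0 at the exponent s = 1/(q sigma'), chosen so that
s q sigma' = 1.  It bounds Xnorm w0 s f, so f lies in X_{w0}^s, which is X_{w0}
by hypothesis; only then does the John-Nirenberg inequality from s to 1
apply to f. *)
Lemma Xnorm_w0_le_backward w q (sigma : R) f : (1 < q)%R -> (1 < sigma)%R ->
  Ap mu BB q w -> RH mu BB sigma w0 -> Xspace mu BB Lam w 1 f ->
  Xspace mu BB Lam w0 1 f /\
  Xnorm mu BB Lam w0 1 f <= backward_const w q sigma * Xnorm mu BB Lam w 1 f.
Proof.
move=> q1 sigma1 Aw RHw0 Xf.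
have s01 := backward_exponent_lt1 q1 sigma1; rewrite /backward_const.
have qs0 : (q * conj_exp sigma != 0)%R.
  by case/andP: s01 => /[!invr_gt0] /gt_eqF ->.
move: s01 qs0; set e := (q * conj_exp sigma)%R => s01 e0.
have /andP[s0 s1] := s01.
have := Xnorm_transfer BB_measurable BB_measure Lam_ge0
  Lam_measurable f q1 sigma1 s0 Aw RHw0.
have /andP[A0 _] := Ap_const_fin Aw.
have -> : (e^-1 * q * conj_exp sigma = 1)%R by rewrite -mulrA mulVf.
have -> : (q * conj_exp sigma / e = 1)%R by rewrite divff.
rewrite invr1 invrK (poweRe1 A0).
move=> H.
have fin : Xnorm mu BB Lam w0 e^-1 f < +oo.
  apply: le_lt_trans H _.
  have /andP[//] : 0 <= RH_const mu BB sigma w0 `^ e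
     * Ap_const mu BB q w * Xnorm mu BB Lam w 1 f < +oo.
  apply: mule_fin_ge0; last by rewrite Xnorm_ge0.
  by apply: mule_fin_ge0; [exact/poweR_fin_ge0/RH_const_fin|exact: Ap_const_fin].
have X0f : Xspace mu BB Lam w0 1 f by rewrite -(w0_small s01).
split=> //; apply: le_trans (Xnorm_JN_const s01 X0f fin) _.
rewrite -!muleA; apply: lee_wpmul2l.
  by have /andP[] := JN_const_fin s01.
by rewrite muleCA muleA.
Qed.
End comparison.

(** * Comparability of all A_infinity weights *)

Theorem theorem3p3 (d : measure_display) (Y : measurableType d) (R : realType)
    (mu : {measure set Y -> \bar R}) (BB : set (set Y))
    (F : Type) (Lam : F -> set Y -> Y -> R) (w0 : Y -> R)
    (mu_sigma_finite : sigma_finite [set: Y] mu)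
    (BB_measurable : forall B, BB B -> measurable B)
    (BB_measure : forall B, BB B -> 0 < mu B < +oo)
    (Lam_ge0 : forall f B, BB B -> forall x, (0 <= Lam f B x)%R)
    (Lam_measurable : forall f B, BB B -> measurable_fun [set: Y] (Lam f B))
    (Ainfty_RH : Ainfty mu BB =
       \bigcup_(delta in [set delta : R | (1 < delta)%R]) RH mu BB delta)
    (w0_Ainfty : Ainfty mu BB w0)
    (w0_JN : JN_property mu BB Lam w0 `[1%R, +oo[)
    (w0_small : forall p : R, (0 < p < 1)%R ->
       Xspace mu BB Lam w0 p = Xspace mu BB Lam w0 1) :
  [/\ weight_invariance mu BB Lam (Ainfty mu BB),
      (forall w, Ainfty mu BB w -> JN_property mu BB Lam w `]0%R, +oo[)
    & forall (w : Y -> R) (p q delta sigma : R),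
        (1 < p)%R -> (1 < q)%R -> (1 < delta)%R -> (1 < sigma)%R ->
        (Ap mu BB p `&` RH mu BB sigma) w0 ->
        (Ap mu BB q `&` RH mu BB delta) w ->
        [/\ invariance_const mu BB Lam w0 w
              <= JN_const mu BB Lam w0 1 (p * conj_exp delta)
                 * (Ap_const mu BB p w0) `^ (p * conj_exp delta)^-1
                 * RH_const mu BB delta w,
            invariance_const mu BB Lam w w0
              <= JN_const mu BB Lam w0 (q * conj_exp sigma)^-1 1
                 * Ap_const mu BB q w
                 * (RH_const mu BB sigma w0) `^ (q * conj_exp sigma)
          & forall t : R, (1 < t)%R ->
              JN_const mu BB Lam w 1 t
                <= JN_const mu BB Lam w0 1 (t * p * conj_exp delta)
                   * invariance_const mu BB Lam w w0
                   * (Ap_const mu BB p w0) `^ (p * conj_exp delta * t)^-1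
                   * (RH_const mu BB delta w) `^ t^-1]].
Proof.
have Ainfty_Ap_RH w : Ainfty mu BB w -> exists p delta : R,
    [/\ (1 < p)%R, (1 < delta)%R, Ap mu BB p w & RH mu BB delta w].
  move=> /[dup] [[p /= p1 Aw]]; rewrite Ainfty_RH => -[delta /= d1 RHw].
  by exists p, delta.
have pw w : Ainfty mu BB w -> positive_weight mu BB w.
  exact: Ainfty_positive_weight.
have JN0 : JN_property mu BB Lam w0 `]0%R, +oo[.
  apply: JN_property_from_one (pw _ w0_Ainfty) _ => // t t1.
  by apply: w0_JN => //; rewrite in_itv/= andbT ?lexx ?ltW.
have [p0 [sigma0 [p01 sigma01 Aw0 RHw0]]] := Ainfty_Ap_RH _ w0_Ainfty.
pose X w := Xspace mu BB Lam w 1.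
pose N w := Xnorm mu BB Lam w 1.
(* The reference weight has its own exponents p0 and sigma0, so that one
   choice serves every other weight w. *)
have comparable w : Ainfty mu BB w -> exists2 K : \bar R, 0 <= K < +oo &
    forall f, X w0 f -> N w f <= K * N w0 f.
  move=> /Ainfty_Ap_RH[q [delta [q1 d1 Aw RHw]]].
  exists (forward_const mu BB Lam w0 w p0 1 delta).
    exact: forward_const_fin.
  by move=> f; apply: Xnorm_le_forward.
have comparable' w : Ainfty mu BB w -> exists2 K : \bar R, 0 <= K < +oo &
    forall f, X w f -> X w0 f /\ N w0 f <= K * N w f.
  move=> /Ainfty_Ap_RH[q [delta [q1 d1 Aw RHw]]].
  exists (backward_const mu BB Lam w0 w q sigma0).
    exact: backward_const_fin.
  by move=> f; apply: Xnorm_w0_le_backward.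
have invariance : weight_invariance mu BB Lam (Ainfty mu BB).
  have bound w v : Ainfty mu BB w -> Ainfty mu BB v ->
      exists2 K : \bar R, 0 <= K < +oo &
      forall f, X w f -> N v f <= K * N w f.
    move=> /comparable'[K1 K1fin H1] /comparable[K2 K2fin H2].
    exists (K2 * K1); first exact: mule_fin_ge0.
    move=> f /H1[/H2 H K1f]; apply: le_trans H _; rewrite -muleA.
    by apply: lee_wpmul2l => //; case/andP: K2fin.
  have sub w v : Ainfty mu BB w -> Ainfty mu BB v -> X w `<=` X v.
    move=> Aw Av f Xf; have [K Kfin /(_ f Xf) H] := bound w v Aw Av.
    apply: le_lt_trans H _.
    have /andP[//] : 0 <= K * N w f < +oo.
    by apply: mule_fin_ge0 => //; rewrite Xnorm_ge0.
  move=> w v Aw Av; split; first by apply/seteqP; split; exact: sub.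
  have [K Kfin H] := bound w v Aw Av.
  by apply: (real_constant Kfin _ H) => f; exact: Xnorm_ge0.
have b_bound w f : Ainfty mu BB w -> X w f ->
    N w0 f <= invariance_const mu BB Lam w w0 * N w f.
  move=> Aw Xf; apply: (@best_constantP _ _ (X w)) => //.
    by have [] := invariance w w0 Aw w0_Ainfty.
  by rewrite Xnorm_ge0.
have b_ge0 w : Ainfty mu BB w -> 0 <= invariance_const mu BB Lam w w0 < +oo.
  move=> Aw; apply: (@best_constant_bounds _ _ (X w)).
  by have [] := invariance w w0 Aw w0_Ainfty.
have JN_from_w0 w p delta t : (1 < p)%R -> (1 < delta)%R -> (1 < t)%R ->
    Ap mu BB p w0 -> RH mu BB delta w ->
    forall f, X w f -> Xnorm mu BB Lam w t f <=
      forward_const mu BB Lam w0 w p t delta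
      * invariance_const mu BB Lam w w0 * N w f.
  move=> p1 d1 t1 Apw0 RHw f Xf; have Aw : Ainfty mu BB w by case: RHw.
  have X0f : X w0 f by rewrite /X; have [-> _] := invariance _ _ w0_Ainfty Aw.
  apply: le_trans (Xnorm_le_forward BB_measurable BB_measure Lam_ge0
    Lam_measurable JN0 p1 d1 (ltW t1) Apw0 RHw X0f) _.
  rewrite -[leRHS]muleA; apply: lee_wpmul2l; last exact: b_bound.
  by case/andP: (forward_const_fin BB_measurable BB_measure JN0 p1 d1 (ltW t1)
    Apw0 RHw).
split; [exact: invariance|move=> w Aw
  |move=> w p q delta sigma p1 q1 d1 s1 [Apw0 RHsw0] [Aqw RHw]].
  have [q [delta [q1 d1 Aqw RHw]]] := Ainfty_Ap_RH _ Aw.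
  apply: JN_property_from_one (pw _ Aw) _ => // t t1.
  apply: real_constant (JN_from_w0 w p0 delta t p01 d1 t1 Aw0 RHw).
    by apply: mule_fin_ge0; [apply: forward_const_fin => //; exact: ltW|exact: b_ge0].
  by move=> f; exact: Xnorm_ge0.
have Aw : Ainfty mu BB w by case: RHw.
split.
- rewrite (_ : _ * _ = forward_const mu BB Lam w0 w p 1 delta).
    apply: best_constant_le.
    + by case/andP: (forward_const_fin BB_measurable BB_measure JN0 p1 d1
        (lexx _) Apw0 RHw).
    + by move=> f; exact: Xnorm_ge0.
    + by move=> f; apply: Xnorm_le_forward.
  rewrite /forward_const mul1r mulr1 invr1 poweRe1//.
  by case/andP: (RH_const_fin BB_measurable BB_measure RHw).
- apply: (@best_constant_le _ _ _ _ _ (backward_const mu BB Lam w0 w q sigma)).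
  + by case/andP: (backward_const_fin BB_measurable BB_measure JN0 q1 s1 Aqw RHsw0).
  + by move=> f; exact: Xnorm_ge0.
  + by move=> f Xf; apply: (Xnorm_w0_le_backward _ _ _ _ _ _ _ _ _ _ Xf).2.
- move=> t t1.
  rewrite (_ : _ * _ = forward_const mu BB Lam w0 w p t delta
    * invariance_const mu BB Lam w w0).
    apply: best_constant_le (JN_from_w0 w p delta t p1 d1 t1 Apw0 RHw).
    + rewrite mule_ge0//; last by case/andP: (b_ge0 w Aw).
      by case/andP: (forward_const_fin BB_measurable BB_measure JN0 p1 d1
        (ltW t1) Apw0 RHw).
    + by move=> f; exact: Xnorm_ge0.
  by rewrite /forward_const [RHS]muleAC; congr (_ * _); exact: muleAC.
Qed.
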